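(* Let $\mathbf i=(i_1,i_2,\dots)\in\mathbb{N}^{\mathbb{N}}$ and let $\mu_{\mathbf i}$ be the corresponding infinite mutation sequence on $\mathbf{AF}$. Then: (i) $\mathcal D_{\mathbf{AF}}(\mu_{\mathbf i})$ is dense in $\mathbf{AF}$; (ii) if no $i\in\mathbb{N}$ appears infinitely many times in $\mathbf i$, then $\mathcal C_{\mathbf{AF}}(\mu_{\mathbf i})$ is dense in $\mathbf{AF}$; (iii) if only finitely many distinct $i\in\mathbb{N}$ appear in $\mathbf i$, then $\mathcal C_{\mathbf{AF}}(\mu_{\mathbf i})$ is not dense in $\mathbf{AF}$.
   Context: $\mathbb{N}$ is the positive integers. A quiver on $\mathbb{N}$ is a function $Q:\mathbb{N}\times\mathbb{N}\to\mathbb{Z}$ with $Q(x,y)=-Q(y,x)$. For $V\subseteq\mathbb{N}$, $\rho_V(Q)(x,y)=Q(x,y)$ if $x,y\in V$, else $0$. $\mathbf{AF}$ is the set of all quivers on $\mathbb{N}$ with the topology generated by the basic sets $U_{Q,V}=\{Q':\rho_V(Q')=\rho_V(Q)\}$, $V$ finite. Mutation at $x$: $\mu_x(Q)(v,w)=-Q(v,w)$ if $x\in\{v,w\}$, and otherwise $\mu_x(Q)(v,w)=Q(v,w)+Q(v,x)[Q(x,w)]_++[-Q(v,x)]_+Q(x,w)$, where $[a]_+=\max(a,0)$. For $\mathbf i\in\mathbb{N}^{\mathbb{N}}$, $\mu_{\mathbf i}$ converges on $Q$ if the sequence $(\mu_{i_m}\circ\cdots\circ\mu_{i_1}(Q))_{m\ge1}$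 converges in $\mathbf{AF}$, and diverges on $Q$ otherwise. $\mathcal C_{\mathbf{AF}}(\mu_{\mathbf i})$ is the set of $Q\in\mathbf{AF}$ on which $\mu_{\mathbf i}$ converges and $\mathcal D_{\mathbf{AF}}(\mu_{\mathbf i})=\mathbf{AF}\setminus\mathcal C_{\mathbf{AF}}(\mu_{\mathbf i})$. *)

(* Defs.v *)
From HB Require Import structures.
From mathcomp Require Import all_boot all_order all_algebra.
From mathcomp Require Import boolp classical_sets cardinality filter topology.
From mathcomp Require Import ring.

Set Implicit Arguments.
Unset Strict Implicit.
Unset Printing Implicit Defensive.

Import Order.TTheory GRing.Theory Num.Theory.

Local Open Scope classical_set_scope.
Local Open Scope ring_scope.

Definition posN : Type := {n : nat | (0 < n)%N}.
HB.instance Definition _ := Countable.on posN.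

Record AF : Type := Quiver {
  arrows :> posN -> posN -> int;
  arrows_anti : forall x y, arrows x y = - arrows y x
}.

HB.instance Definition _ := gen_eqMixin AF.
HB.instance Definition _ := gen_choiceMixin AF.

Lemma AF_eqP (Q Q' : AF) : (forall x y, Q x y = Q' x y) -> Q = Q'.
Proof.
case: Q Q' => [q hq] [q' hq'] /= qq'.
have {}qq' : q = q' by apply/funext => x; apply/funext => y.
by subst q'; congr Quiver; exact: Prop_irrelevance.
Qed.

Lemma empty_quiver_anti (x y : posN) : (0 : int) = - 0.
Proof. by rewrite oppr0. Qed.

Definition empty_quiver : AF := Quiver empty_quiver_anti.
HB.instance Definition _ := isPointed.Build AF empty_quiver.

Definition restr_fun (V : set posN) (Q : AF) (x y : posN) : int :=
  if (x \in V) && (y \in V) then Q x y else 0.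

Lemma restr_fun_anti V Q x y : restr_fun V Q x y = - restr_fun V Q y x.
Proof.
by rewrite /restr_fun andbC; case: ifP => _; rewrite ?oppr0 // arrows_anti.
Qed.

Definition restr (V : set posN) (Q : AF) : AF := Quiver (restr_fun_anti V Q).

Definition AF_basic (QV : AF * set posN) : set AF :=
  [set Q' | restr QV.2 Q' = restr QV.2 QV.1].

Definition AF_index : set (AF * set posN) := [set QV | finite_set QV.2].

Lemma AF_basic_cover : \bigcup_(QV in AF_index) AF_basic QV = setT.
Proof.
rewrite -subTset => Q _; exists (Q, set0) => //; exact: finite_set0.
Qed.

Lemma restr_sub (V W : set posN) (Q Q' : AF) :
  V `<=` W -> restr W Q = restr W Q' -> restr V Q = restr V Q'.
Proof.
move=> VW e; apply: AF_eqP => x y /=; rewrite /restr_fun.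
case: ifP => // /andP[]; rewrite !inE => /VW xW /VW yW.
have /(congr1 (fun q : AF => q x y)) := e.
by rewrite /= /restr_fun !mem_set.
Qed.

Lemma AF_basic_join (i j : AF * set posN) (Q : AF) :
  AF_index i -> AF_index j -> AF_basic i Q -> AF_basic j Q ->
  exists k, [/\ AF_index k, AF_basic k Q &
                AF_basic k `<=` AF_basic i `&` AF_basic j].
Proof.
move=> fi fj iQ jQ; exists (Q, i.2 `|` j.2); split => //.
  by rewrite /AF_index /= finite_setU.
move=> Q' /= e; split; rewrite /AF_basic /=.
  by rewrite -iQ; apply: restr_sub e; exact: subsetUl.
by rewrite -jQ; apply: restr_sub e; exact: subsetUr.
Qed.

HB.instance Definition _ :=
  isBaseTopological.Build AF AF_basic_cover AF_basic_join.

Definition pos_part (a : int) : int := Num.max a 0.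

Definition mut_fun (x : posN) (Q : AF) (v w : posN) : int :=
  if (x == v) || (x == w) then - Q v w
  else Q v w + Q v x * pos_part (Q x w) + pos_part (- Q v x) * Q x w.

Lemma mut_fun_anti x Q v w : mut_fun x Q v w = - mut_fun x Q w v.
Proof.
rewrite /mut_fun orbC; case: ifP => _; first by rewrite (arrows_anti Q v).
rewrite (arrows_anti Q w v) (arrows_anti Q w x) (arrows_anti Q x v) opprK.
by ring.
Qed.

Definition mut (x : posN) (Q : AF) : AF := Quiver (mut_fun_anti x Q).

(* Sequences are indexed from 0, so i n is the (n+1)-st mutation vertex and
   mut_seq i n Q = mu_{i n} (... (mu_{i 0} Q)). *)
Fixpoint mut_seq (i : nat -> posN) (n : nat) (Q : AF) : AF :=
  if n is m.+1 then mut (i m.+1) (mut_seq i m Q) else mut (i 0%N) Q.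

Definition mut_converges (i : nat -> posN) (Q : AF) : Prop :=
  cvg ((fun n => mut_seq i n Q) @ \oo).

Definition conv_AF (i : nat -> posN) : set AF := [set Q | mut_converges i Q].

Definition div_AF (i : nat -> posN) : set AF := ~` conv_AF i.

(* Main.v *)
(** A mutation at a vertex [x] only uses arrows between [x] and the two vertices
    observed, and it is an involution; hence the quiver at a late time [m] can
    be altered at the arrows of a vertex that has not been mutated so far, and
    pulled back to an initial quiver that is only altered at that same vertex.

    If only finitely many vertices are mutated, then from some time on only
    vertices of the set [T] of infinitely recurring ones are.  At such a time
    put an arrow between a never mutated vertex [y] and [T].  Mutating at [T]
    never erases all arrows between [y] and [T], whereas convergence would
    force them to vanish, since mutating at [x] flips the sign of the arrows at
    [x].  This obstruction only involves finitely many arrows of the initial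
    quiver, so it holds on a whole open set.

    If infinitely many vertices are mutated, fix two vertices [a] and [b].
    When a vertex [z] is mutated for the first time, its arrows can be adjusted
    so that there is exactly one path [a -> z -> b], and the mutation changes
    the number of arrows from [a] to [b].  So the quivers for which this number
    changes after time [k] form a dense open set, and a Baire category argument
    yields quivers for which it changes infinitely often.

    If no vertex recurs infinitely often, then every finitely supported quiver
    converges: mutations outside its support do nothing. *)

Require Import Defs.
From mathcomp Require Import all_boot all_order all_algebra.
From mathcomp Require Import boolp classical_sets cardinality filter topology.
From mathcomp Require Import ring zify.

Local Open Scope classical_set_scope.

Set Implicit Arguments.
Unset Strict Implicit.
Unset Printing Implicit Defensive.

Import Order.TTheory GRing.Theory Num.Theory.

(** * Agreement on vertex sets and the topology of [AF] *)

Definition agree (V : set posN) (Q Q' : AF) : Prop :=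
  forall x y, V x -> V y -> Q x y = Q' x y.

Lemma agree_refl V Q : agree V Q Q.
Proof. by []. Qed.

Lemma agree_trans V Q1 Q2 Q3 : agree V Q1 Q2 -> agree V Q2 Q3 -> agree V Q1 Q3.
Proof. by move=> e f x y Vx Vy; rewrite e // f. Qed.

Lemma agree_sub V W Q Q' : V `<=` W -> agree W Q Q' -> agree V Q Q'.
Proof. by move=> VW e x y /VW Wx /VW Wy; exact: e. Qed.

Lemma AF_basicE Q V Q' : AF_basic (Q, V) Q' <-> agree V Q Q'.
Proof.
rewrite /AF_basic /=; split => [e x y Vx Vy|e].
  have /(congr1 (fun q : AF => q x y)) := e.
  by rewrite /= /restr_fun !mem_set.
apply: AF_eqP => x y /=; rewrite /restr_fun.
by case: ifP => // /andP[]; rewrite !inE => Vx Vy; rewrite e.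
Qed.

Lemma open_AF_basic Q V : finite_set V -> open (AF_basic (Q, V)).
Proof.
move=> fV; exists [set (Q, V)]; first by move=> _ ->.
by rewrite bigcup_set1.
Qed.

Lemma open_agree (O : set AF) Q : open O -> O Q ->
  exists2 V, finite_set V & forall Q', agree V Q Q' -> O Q'.
Proof.
move=> [D DI <-] [[P V] DPV /AF_basicE PQ].
exists V; first exact: (DI _ DPV).
move=> Q' QQ'; exists (P, V) => //.
by apply/AF_basicE; exact: agree_trans PQ QQ'.
Qed.

Lemma mut_converges_cst i Q (x y : posN) : mut_converges i Q ->
  exists M c, forall m, (M <= m)%N -> mut_seq i m Q x y = c.
Proof.
move=> /cvg_ex[/= L QL].
have /QL[M _ MQ] : nbhs L (AF_basic (L, [set x; y])).
  apply: open_nbhs_nbhs; split; last exact/AF_basicE/agree_refl.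
  exact/open_AF_basic/finite_set2.
exists M, (L x y) => m Mm.
have /AF_basicE -> // : AF_basic (L, [set x; y]) (mut_seq i m Q) by exact: MQ.
  by left.
by right.
Qed.

Lemma eventually_cst_mut_converges i Q M :
  (forall m, (M <= m)%N -> mut_seq i m Q = mut_seq i M Q) -> mut_converges i Q.
Proof.
move=> e; apply/cvg_ex; exists (mut_seq i M Q); apply: cvg_near_cst.
by exists M => // m /= /e ->.
Qed.

(** * Locality and invertibility of mutation *)

Lemma mut_loc x V Q Q' : V x -> agree V Q Q' -> agree V (mut x Q) (mut x Q').
Proof.
by move=> Vx e v w Vv Vw; rewrite /= /mut_fun !e.
Qed.

Local Open Scope ring_scope.

Lemma pos_partBN (c : int) : pos_part c - pos_part (- c) = c.
Proof. by rewrite /pos_part; lia. Qed.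

(** The second mutation sees [- a] and [- b]; by [pos_partBN] the two corrections add up to
    [a * b - a * b]. *)
Lemma mutK x : involutive (mut x).
Proof.
move=> Q; apply: AF_eqP => v w; rewrite /= /mut_fun /= /mut_fun !eqxx !orbT /=.
case: ifP => vw; rewrite vw ?opprK //.
set a := Q v x; set b := Q x w.
have -> : Q v w + a * pos_part b + pos_part (- a) * b + - a * pos_part (- b) +
    pos_part a * - b =
    Q v w + a * (pos_part b - pos_part (- b)) -
    (pos_part a - pos_part (- a)) * b by ring.
by rewrite !pos_partBN addrK.
Qed.

Lemma mut_seq_loc i m V Q Q' : (forall k, (k <= m)%N -> V (i k)) ->
  agree V Q Q' -> agree V (mut_seq i m Q) (mut_seq i m Q').
Proof.
elim: m => [|m IH] /= iV QQ'; first by apply: mut_loc => //; exact: iV.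
by apply: mut_loc; [exact: iV|apply: IH => // k /leqW; exact: iV].
Qed.

Lemma mut_seq_lift i m V Q P : (forall k, (k <= m)%N -> V (i k)) ->
  agree V (mut_seq i m Q) P ->
  exists2 Q', agree V Q Q' & mut_seq i m Q' = P.
Proof.
elim: m P => [|m IH] P /= iV QP.
  exists (mut (i 0%N) P); last exact: mutK.
  by rewrite -(mutK (i 0%N) Q); apply: mut_loc => //; exact: iV.
have [||Q' QQ' Q'P] := IH (mut (i m.+1) P).
- by move=> k /leqW; exact: iV.
- by rewrite -(mutK (i m.+1) (mut_seq i m Q)); apply: mut_loc => //; exact: iV.
by exists Q' => //; rewrite Q'P mutK.
Qed.

Lemma exists_row (P : AF) (z : posN) (f : posN -> int) :
  exists2 P' : AF, agree (~` [set z]) P P' &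
    forall y, y != z -> P' z y = f y.
Proof.
pose g x y : int := if x == z then (if y == z then 0 else f y)
                    else if y == z then - f x else P x y.
have g_anti x y : g x y = - g y x.
  rewrite /g; case: (eqVneq x z) => _; case: (eqVneq y z) => _;
    by rewrite ?oppr0 ?opprK // arrows_anti.
exists (Quiver g_anti).
  by move=> x y /eqP/negPf xz /eqP/negPf yz; rewrite /= /g xz yz.
by move=> y /negPf yz; rewrite /= /g eqxx yz.
Qed.

Lemma exists_late_row i m Q z (f : posN -> int) :
  (forall k, (k <= m)%N -> i k != z) ->
  exists2 Q', agree (~` [set z]) Q Q' &
    forall y, y != z -> mut_seq i m Q' z y = f y.
Proof.
move=> iz; have [P QP Pf] := exists_row (mut_seq i m Q) z f.
have [|Q' QQ' Q'P] := mut_seq_lift _ QP; first by move=> k /iz/eqP.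
by exists Q' => //; rewrite Q'P.
Qed.

Lemma mut_incident (Q : AF) x y : mut x Q y x = - Q y x.
Proof. by rewrite /= /mut_fun eqxx orbT. Qed.

Lemma mut_id (Q : AF) x : (forall y, Q x y = 0) -> mut x Q = Q.
Proof.
move=> Qx; apply: AF_eqP => v w; rewrite /= /mut_fun.
have Qx' y : Q y x = 0 by rewrite arrows_anti Qx oppr0.
case: ifP => [/orP[] /eqP<-|_]; rewrite ?Qx ?Qx' ?oppr0 //.
by rewrite !(mul0r, mulr0, addr0).
Qed.

(** A nonzero [Q y x] only changes sign; if it is zero, both correction terms vanish in the row of
    [y]. *)
Lemma mut_linked (T : set posN) x y (Q : AF) : T x -> y != x ->
  (exists2 w, T w & Q y w != 0) -> exists2 w, T w & mut x Q y w != 0.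
Proof.
move=> Tx yx [w Tw Qyw]; have [Qyx|Qyx] := eqVneq (Q y x) 0; last first.
  by exists x => //; rewrite mut_incident oppr_eq0.
exists w => //; rewrite /= /mut_fun Qyx oppr0 mul0r /pos_part maxxx mul0r !addr0.
by rewrite [x == y]eq_sym (negPf yx) /=; case: ifP => _; rewrite ?oppr_eq0.
Qed.

Local Close Scope ring_scope.

(** * Initial segments and recurrent vertices *)

Lemma finite_bounded (X : eqType) (V : set X) (g : X -> nat) :
  finite_set V -> exists n, forall x, V x -> g x <= n.
Proof.
move=> /finite_seqP[s ->]; exists (\max_(x <- s) g x) => x xs.
exact: leq_bigmax_seq.
Qed.

Definition seg (n : nat) : set posN := [set x | sval x <= n].

Lemma seg_le m n : m <= n -> seg m `<=` seg n.
Proof. by move=> mn x /= xm; exact: leq_trans mn. Qed.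

Lemma finite_sub_seg V : finite_set V -> exists n, V `<=` seg n.
Proof. by move=> /(finite_bounded (fun x : posN => sval x)). Qed.

Lemma finite_seg n : finite_set (seg n).
Proof.
apply: (@sub_finite_set _ _ [set insubd (exist _ 1 isT : posN) k | k in `I_n.+1]).
  by move=> x /= xn; exists (sval x); rewrite ?valKd.
exact/finite_image/finite_II.
Qed.

Definition recurrent (i : nat -> posN) : set posN :=
  [set x | forall m, exists2 n, m <= n & i n = x].

Lemma recurrent_or_not i x :
  recurrent i x \/ (exists m, forall n, m <= n -> i n != x).
Proof.
have [|] := pselect (recurrent i x); first by left.
move=> /existsNP[m mx]; right; exists m => n mn; apply/eqP => inx.
by apply: mx; exists n.
Qed.

Lemma eventually_recurrent i : finite_set (range i) ->
  exists M, forall m, M <= m -> recurrent i (i m).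
Proof.
move=> fi.
have [x|N NP] := @choice posN nat (fun x N => recurrent i x \/
    forall n, N <= n -> i n != x).
  by have [ix|[m mx]] := recurrent_or_not i x; [exists 0; left|exists m; right].
have [M NM] := finite_bounded N fi.
exists M => m Mm; have [//|] := NP (i m).
have Nm : N (i m) <= m by apply: leq_trans Mm; apply: NM; exists m.
by move=> /(_ m Nm); rewrite eqxx.
Qed.

(** * Divergence when finitely many vertices are mutated *)

Lemma linked_diverges i y M (Q : AF) : finite_set (recurrent i) ->
  (forall n, i n != y) ->
  (forall m, M <= m -> recurrent i (i m)) ->
  (exists2 w, recurrent i w & mut_seq i M Q y w != 0%R) ->
  ~ mut_converges i Q.
Proof.
move=> fT iy iM QM Qcvg.
have linked m : exists2 w, recurrent i w & mut_seq i (m + M) Q y w != 0%R.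
  elim: m => // m IH; rewrite addSn /=; apply: mut_linked IH; last first.
    by rewrite eq_sym iy.
  by apply: iM; rewrite -addSn leq_addl.
have [w|N NP] := @choice posN nat (fun w N => recurrent i w ->
    forall m, N <= m -> mut_seq i m Q y w = 0%R).
  have [N [c Nc]] := mut_converges_cst y w Qcvg.
  (* An occurrence of [w] from [N.+1] on has a preceding time [n] that is still at least [N], so the
     sign flip equates the constant with its opposite. *)
  exists N => /(_ N.+1)[[//|n]]; rewrite ltnS => Nn inw m Nm.
  rewrite Nc //; apply/eqP; rewrite -eqNr; apply/eqP.
  have flip : mut_seq i n.+1 Q y w = (- mut_seq i n Q y w)%R.
    by rewrite -inw; exact: mut_incident.
  by rewrite -{1}(Nc n) // -flip Nc // leqW.
have [K NK] := finite_bounded N fT.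
have [w iw] := linked K.
by rewrite (NP w iw) ?eqxx // (leq_trans (NK _ iw)) // leq_addr.
Qed.

Lemma finite_range_diverges i Q n : finite_set (range i) ->
  exists Q' n', agree (seg n) Q Q' /\
    forall Q'', agree (seg n') Q' Q'' -> div_AF i Q''.
Proof.
move=> fi; have [M iM] := eventually_recurrent fi.
have [k ik] := finite_sub_seg fi.
(* Beyond [seg n], where [Q] must be kept, and beyond [seg k], which contains all mutated
   vertices. *)
pose y : posN := exist _ (n + k).+1 isT.
have iy m : i m != y.
  apply/eqP => imy; have /ik : range i (i m) by exists m.
  by rewrite imy /seg /= ltnNge leq_addl.
have [|Q' QQ' Q'y] := @exists_late_row i M Q y (fun=> 1%R); first by [].
exists Q', (n + k).+1; split.
  apply: agree_sub QQ' => x + xy.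
  by rewrite /seg xy /= ltnNge leq_addr.
move=> Q'' Q'Q''; apply: (@linked_diverges _ y M) => //.
  apply: sub_finite_set fi => x /(_ 0)[m _ <-]; by exists m.
exists (i M); first exact: iM.
have seg_i m : seg (n + k).+1 (i m).
  have /ik : range i (i m) by exists m.
  by apply: seg_le; rewrite leqW // leq_addl.
have <- : mut_seq i M Q' y (i M) = mut_seq i M Q'' y (i M).
  by apply: (mut_seq_loc (V := seg (n + k).+1)) => //; exact: leqnn.
by rewrite Q'y ?oner_eq0.
Qed.

(** * Baire category and infinitely many mutated vertices *)

Lemma baire_AF (P : nat -> AF -> Prop) :
  (forall k Q n, exists Q' n', agree (seg n) Q Q' /\
     forall Q'', agree (seg n') Q' Q'' -> P k Q'') ->
  forall Q n, exists2 Q', agree (seg n) Q Q' & forall k, P k Q'.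
Proof.
move=> Pdense Q n.
have [[k [R r]]|f fP] := @choice (nat * (AF * nat)) (AF * nat)
    (fun u v => agree (seg u.2.2) u.2.1 v.1 /\
      forall Q'', agree (seg v.2) v.1 Q'' -> P u.1 Q'').
  by have [R' [r' [RR' R'P]]] := Pdense k R r; exists (R', r').
(* Nested basic open sets, the next one inside [P k']; the successor in the [maxn] makes the radii
   tend to infinity. *)
pose s := fix s k := if k is k'.+1
  then ((f (k', s k')).1, maxn (f (k', s k')).2 (s k').2.+1) else (Q, n).
have s_ge k : k <= (s k).2.
  by elim: k => //= k IH; rewrite leq_max ltnS IH orbT.
have s_le k l : k <= l -> (s k).2 <= (s l).2.
  move=> kl; rewrite -(subnK kl); elim: (l - k) => //= m IH.
  by rewrite leq_max (leq_trans IH (leqnSn _)) orbT.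
have s_agree k l : k <= l -> agree (seg (s k).2) (s k).1 (s l).1.
  move=> kl; rewrite -(subnK kl); elim: (l - k) => //= m IH.
  apply: agree_trans IH _; have [+ _] := fP (m + k, s (m + k)).
  by apply: agree_sub; apply/seg_le/s_le/leq_addl.
(* The limit is read at a stage whose segment already contains [x] and [y]; the sum is symmetric,
   which gives antisymmetry. *)
pose L0 x y := (s (sval x + sval y)).1 x y.
have L0_anti x y : L0 x y = (- L0 y x)%R.
  by rewrite /L0 addnC arrows_anti.
pose L := Quiver L0_anti.
have s_L k : agree (seg (s k).2) (s k).1 L.
  move=> x y xk yk; rewrite /= /L0; set l := _ + _.
  have [xl yl] : seg (s l).2 x /\ seg (s l).2 y.
    by split; apply: leq_trans (s_ge l); rewrite ?leq_addl ?leq_addr.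
  have [kl|/ltnW lk] := leqP k l; first exact: s_agree.
  by apply/esym/s_agree.
exists L; first exact: (s_L 0).
move=> k; have [_] := fP (k, s k); apply.
by apply: agree_sub (s_L k.+1); apply/seg_le/leq_maxl.
Qed.

Lemma first_occurrence i n M : infinite_set (range i) ->
  exists2 m, M <= m & (forall k, k <= m -> i k != i m.+1) /\ ~ seg n (i m.+1).
Proof.
move=> infi.
(* The least index whose vertex avoids [F] is a first occurrence; the image part forces it past
   [M]. *)
pose F := seg n `|` i @` `I_M.+1.
have fF : finite_set F.
  rewrite finite_setU; split; first exact: finite_seg.
  exact/finite_image/finite_II.
have exF : exists k, `[< ~ F (i k) >].
  apply: contrapT => noF; apply/infi/(sub_finite_set _ fF) => _ [k _ <-].
  by apply: contrapT => Fk; apply: noF; exists k; apply/asboolP.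
case: (ex_minnP exF) => -[|m] /asboolP mF minm.
  by case: mF; right; exists 0.
exists m.
  rewrite leqNgt; apply/negP => mM; apply: mF; right; exists m.+1 => //.
split=> [k km|mn]; last by apply: mF; left.
apply/eqP => ikm; have : m.+1 <= k by apply: minm; apply/asboolP; rewrite ikm.
by rewrite ltnNge km.
Qed.

Lemma infinite_range_diverges i Q n : infinite_set (range i) ->
  exists2 Q', agree (seg n) Q Q' & div_AF i Q'.
Proof.
move=> infi.
pose a : posN := exist _ 1 isT; pose b : posN := exist _ 2 isT.
pose P M (R : AF) :=
  exists2 m, M <= m & mut_seq i m R a b != mut_seq i m.+1 R a b.
have [|Q' QQ' PQ'] := @baire_AF P _ Q n; last first.
  exists Q' => // Q'cvg; have [M [c Mc]] := mut_converges_cst a b Q'cvg.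
  by have [m Mm] := PQ' M; rewrite !Mc ?leqW ?eqxx.
move=> M R r.
have [m Mm [mfirst mr]] := first_occurrence (r + 2) M infi.
set z := i m.+1 in mfirst mr.
have zr x : seg (r + 2) x -> x != z.
  by move=> xr; apply: contra_not_neq mr => <-.
have [az bz] : a != z /\ b != z by split; apply: zr; rewrite /seg /= addn2.
(* One arrow from [a] to [z] and one from [z] to [b]: mutating at [z] adds 1 to the entry at [a],
   [b]. *)
have [R' RR' R'z] := @exists_late_row i m R z
  (fun y => if y == b then 1%R else (-1)%R) mfirst.
have [r' Vr'] : exists r', [set a; b] `|` i @` `I_m.+2 `<=` seg r'.
  apply: finite_sub_seg; rewrite finite_setU.
  by split; [exact: finite_set2|exact/finite_image/finite_II].
have [ar' br'] : seg r' a /\ seg r' b.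
  by split; apply: Vr'; left; [left|right].
have ir' k : k <= m.+1 -> seg r' (i k) by move=> km; apply: Vr'; right; exists k.
exists R', r'; split.
  apply: agree_sub RR' => x xr; apply/eqP/zr.
  by apply: seg_le xr; exact: leq_addr.
move=> R'' R'R''; exists m => //.
rewrite -(mut_seq_loc (V := seg r') _ R'R'') // => [|k /leqW]; last exact: ir'.
rewrite -(mut_seq_loc (V := seg r') ir' R'R'') //= -/z /mut_fun.
rewrite ![z == _]eq_sym (negPf az) (negPf bz) /=.
by rewrite (arrows_anti _ a z) !R'z // opprK /pos_part /=; lia.
Qed.

(** * Convergence on finitely supported quivers *)

Lemma mut_support (V : set posN) z (Q : AF) :
  (forall x y, ~ V x -> Q x y = 0%R) ->
  forall x y, ~ V x -> mut z Q x y = 0%R.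
Proof.
move=> QV x y Vx; rewrite /= /mut_fun !(QV x) // oppr0 /pos_part maxxx.
by rewrite !mul0r !addr0; case: ifP.
Qed.

Lemma finite_support_converges i V (Q : AF) :
  (forall x, ~ recurrent i x) -> finite_set V ->
  (forall x y, ~ V x -> Q x y = 0%R) -> mut_converges i Q.
Proof.
move=> ni fV QV.
have supp m x y : ~ V x -> mut_seq i m Q x y = 0%R.
  by elim: m x y => [|m IH]; apply: mut_support.
have [x|N NP] := @choice posN nat (fun x N => forall n, N <= n -> i n != x).
  by have [/ni //|[m mx]] := recurrent_or_not i x; exists m.
have [M NM] := finite_bounded N fV.
apply: (@eventually_cst_mut_converges _ _ M) => m Mm.
rewrite -(subnK Mm); elim: (m - M) => // k <-; rewrite addSn.
(* After time [M] the mutated vertex lies outside [V], so its row is zero. *)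
apply: mut_id => y; apply: supp => Vi.
have /NP := leq_trans (NM _ Vi) (leqW (leq_addl k M)).
by rewrite eqxx.
Qed.

Theorem theorem1p3 (i : nat -> posN) :
  [/\ dense (div_AF i),
      (~ exists x : posN, infinite_set [set n | i n = x]) -> dense (conv_AF i)
    & finite_set [set i n | n in [set: nat]] -> ~ dense (conv_AF i)].
Proof.
split.
- move=> O [Q OQ] oO; have [V fV VO] := open_agree oO OQ.
  have [n Vn] := finite_sub_seg fV.
  have [Q' QQ' Q'div] : exists2 Q', agree (seg n) Q Q' & div_AF i Q'.
    have [fi|] := pselect (finite_set (range i)); last first.
      exact: infinite_range_diverges.
    have [Q' [n' [QQ' Q'P]]] := finite_range_diverges Q n fi.
    by exists Q' => //; apply: Q'P; exact: agree_refl.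
  by exists Q'; split => //; apply: VO; exact: agree_sub QQ'.
- move=> ni O [Q OQ] oO; have [V fV VO] := open_agree oO OQ.
  exists (restr V Q); split.
    by apply: VO => x y Vx Vy; rewrite /= /restr_fun !mem_set.
  apply: (@finite_support_converges _ V) => // [x ix|x y Vx]; last first.
    by rewrite /= /restr_fun memNset.
  apply: ni; exists x => fx.
  have [N NP] := finite_bounded id fx.
  by have [n Nn inx] := ix N.+1; have := NP n inx; rewrite leqNgt Nn.
- move=> fi dC.
  have [Q [n [_ Qdiv]]] := finite_range_diverges empty_quiver 0 fi.
  have [||Q' [/AF_basicE /Qdiv]] // := dC (AF_basic (Q, seg n)).
    by exists Q; apply/AF_basicE; exact: agree_refl.
  exact/open_AF_basic/finite_seg.
Qed.
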